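(* Let $R=[a,b]\times[c,d]$, fix a net $\Delta$ on $R$ and $m,n\in\mathbb{N}$. The multi-valued mapping $\mathcal{T}^\Delta_{m,n}:\mathcal{C}(R)\rightrightarrows\mathcal{C}(R)$ defined by $$\mathcal{T}^\Delta_{m,n}(f)=\{f^\alpha_{\Delta,B_{m,n}}:\alpha\in\mathcal{C}(R),\ \|\alpha\|_\infty<1\}$$ is lower semicontinuous (at every $f\in\mathcal{C}(R)$).
   Context: Here $a<b$, $c<d$, and $\mathcal{C}(R)$ is the Banach space of continuous real functions on $R$ with supremum norm $\|\cdot\|_\infty$. Bernstein operator: for $m,n\in\mathbb{N}$ and $f\in\mathcal{C}(R)$, $$B_{m,n}(f)(x,y)=\frac{1}{(b-a)^m(d-c)^n}\sum_{i=0}^m\sum_{j=0}^n f\Big(a+\tfrac{i(b-a)}{m},c+\tfrac{j(d-c)}{n}\Big)\binom{m}{i}\binom{n}{j}(x-a)^i(b-x)^{m-i}(y-c)^j(d-y)^{n-j}.$$ Net: $\Delta=\{(x_i,y_j):0\le i\le N,\ 0\le j\le M\}$ with $a=x_0<x_1<\dots<x_N=b$ and $c=y_0<y_1<\dots<y_M=d$, $N,M\ge2$. Put $I=[a,b]$, $J=[c,d]$, $I_i=[x_{i-1},x_i]$, $J_j=[y_{j-1},y_j]$, $R_{ij}=I_i\times J_j$. For $1\le i\le N$, $u_i:I\to I_i$ is a contraction that is a homeomorphism onto $I_i$, with $u_i(x_0)=x_{i-1}$, $u_i(x_N)=x_i$ if $i$ is odd and $u_i(x_0)=x_i$, $u_i(x_N)=x_{i-1}$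 if $i$ is even. For $1\le j\le M$, $v_j:J\to J_j$ is a contraction that is a homeomorphism onto $J_j$, with $v_j(y_0)=y_{j-1}$, $v_j(y_M)=y_j$ if $j$ is odd and $v_j(y_0)=y_j$, $v_j(y_M)=y_{j-1}$ if $j$ is even. The maps $u_i,v_j$ are fixed for the net. Put $Q_{ij}(x,y)=(u_i^{-1}(x),v_j^{-1}(y))$ for $(x,y)\in R_{ij}$. $\alpha$-fractal function: for $f\in\mathcal{C}(R)$ and $\alpha\in\mathcal{C}(R)$ with $\|\alpha\|_\infty<1$, $f^\alpha_{\Delta,B_{m,n}}$ is the unique function in $\mathcal{C}(R)$ satisfying, for all $\boldsymbol{x}\in R_{ij}$, $1\le i\le N$, $1\le j\le M$, $$f^\alpha_{\Delta,B_{m,n}}(\boldsymbol{x})=f(\boldsymbol{x})+\alpha(\boldsymbol{x})f^\alpha_{\Delta,B_{m,n}}(Q_{ij}(\boldsymbol{x}))-\alpha(\boldsymbol{x})B_{m,n}(f)(Q_{ij}(\boldsymbol{x})).$$ It is known that this function exists and is unique and that $f\mapsto f^\alpha_{\Delta,B_{m,n}}$ is bounded and linear. A multi-valued mapping $T:X\rightrightarrows Y$ between normed spaces is lower semicontinuous at $x\in X$ if for every open $U\subseteq Y$ with $U\cap T(x)\ne\emptyset$ there is $\delta>0$ such that $U\cap T(x')\ne\emptyset$ whenever $\|x-x'\|_X<\delta$. *)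

(* Defs.v *)
From HB Require Import structures.
From mathcomp Require Import all_boot all_order all_algebra.
From mathcomp Require Import all_classical all_reals all_analysis.

Set Implicit Arguments.
Unset Strict Implicit.
Unset Printing Implicit Defensive.

Import Order.TTheory GRing.Theory Num.Theory.
Import numFieldNormedType.Exports.

Local Open Scope classical_set_scope.
Local Open Scope ring_scope.

Definition rect (R : realType) (a b c d : R) : set (R * R) :=
  `[a, b] `*` `[c, d].

(* The space C([a, b] x [c, d]): the domain is the subtype [set_type], so that
   equality of elements is equality of functions on the rectangle. *)
Definition crect (R : realType) (a b c d : R) : Type :=
  continuousType (set_type (rect a b c d)) R.

HB.instance Definition _ (R : realType) (a b c d : R) :=
  Choice.copy (crect a b c d) (continuousType (set_type (rect a b c d)) R).

Section crect_normed.
Context {R : realType} {a b c d : R}.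
Local Notation C := (crect a b c d).

Local Lemma crectP (f g : C) : f =1 g -> f = g.
Proof. by move=> fg; apply/continuousEP. Qed.

Lemma crect_cts (f : C) : continuous f.
Proof. exact: (@cts_fun _ _ f). Qed.

Local Lemma crect_add_cts (f g : C) : continuous (fun p => f p + g p).
Proof. by move=> p; apply: (cvgD (@crect_cts f p) (@crect_cts g p)). Qed.

Local Lemma crect_opp_cts (f : C) : continuous (fun p => - f p).
Proof. by move=> p; apply: (cvgN (@crect_cts f p)). Qed.

Local Lemma crect_scale_cts (k : R) (f : C) : continuous (fun p => k * f p).
Proof. by move=> p; apply: (cvgM (cvg_cst k) (@crect_cts f p)). Qed.

Definition crect_zero : C := cst 0.
Definition crect_add (f g : C) : C := mkcts (@crect_add_cts f g).
Definition crect_opp (f : C) : C := mkcts (@crect_opp_cts f).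
Definition crect_scale (k : R) (f : C) : C := mkcts (@crect_scale_cts k f).

Local Lemma crect_addA : associative crect_add.
Proof. by move=> f g h; apply: crectP => p; exact: addrA. Qed.

Local Lemma crect_addC : commutative crect_add.
Proof. by move=> f g; apply: crectP => p; exact: addrC. Qed.

Local Lemma crect_add0 : left_id crect_zero crect_add.
Proof. by move=> f; apply: crectP => p; exact: add0r. Qed.

Local Lemma crect_addN : left_inverse crect_zero crect_opp crect_add.
Proof. by move=> f; apply: crectP => p; exact: addNr. Qed.

HB.instance Definition _ :=
  GRing.isZmodule.Build C crect_addA crect_addC crect_add0 crect_addN.

Local Lemma crect_scaleA k l (f : C) :
  crect_scale k (crect_scale l f) = crect_scale (k * l) f.
Proof. by apply: crectP => p; exact: mulrA. Qed.

Local Lemma crect_scale1 : left_id 1 crect_scale.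
Proof. by move=> f; apply: crectP => p; exact: mul1r. Qed.

Local Lemma crect_scaleDr : right_distributive crect_scale +%R.
Proof. by move=> k f g; apply: crectP => p; exact: mulrDr. Qed.

Local Lemma crect_scaleDl (f : C) :
  {morph crect_scale^~ f : k l / k + l}.
Proof. by move=> k l; apply: crectP => p; exact: mulrDl. Qed.

HB.instance Definition _ := GRing.Zmodule_isLmodule.Build R C
  crect_scaleA crect_scale1 crect_scaleDr crect_scaleDl.

Definition crect_norm (f : C) : R := sup (range (fun p => `|f p|)).

Lemma crect_compact : compact (rect a b c d).
Proof. by apply: compact_setX; exact: segment_compact. Qed.

Local Lemma valL_val (h : rect a b c d -> R) p : 'valL_0 h (val p) = h p.
Proof. exact: (congr1 (@^~ p) (valLK 0 h)). Qed.

Local Lemma crect_has_ub (f : C) : has_ubound (range (fun p => `|f p|)).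
Proof.
have [-> | ne] := eqVneq (range (fun p => `|f p|)) set0.
  by exists 0 => ? [].
have cf : continuous (fun p => `|f p|).
  by move=> p; apply: (cvg_norm (@crect_cts f p)).
have [|q _ qmax] := compact_EVT_max _ crect_compact
    (iffRL (subspace_valL_continuousP' _ 0 _) cf).
  by move/set0P: ne => [_ [p _ _]]; exists (val p); exact: set_valP.
exists ('valL_0 (fun p => `|f p|) q) => _ [p _ <-].
rewrite -(valL_val (fun p => `|f p|)).
exact: qmax (val p) (valP p).
Qed.

Lemma crect_norm_ge (f : C) p : `|f p| <= crect_norm f.
Proof. by apply: ub_le_sup; [exact: crect_has_ub | exists p]. Qed.

Lemma crect_norm_le (f : C) (M : R) :
  0 <= M -> (forall p, `|f p| <= M) -> crect_norm f <= M.
Proof.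
move=> M0 fM; rewrite /crect_norm.
have [-> | /set0P ne] := eqVneq (range (fun p => `|f p|)) set0.
  by rewrite sup0.
by apply: ge_sup => // _ [p _ <-].
Qed.

Local Lemma crect_norm_ge0 (f : C) : 0 <= crect_norm f.
Proof.
rewrite /crect_norm.
have [-> | /set0P [_ [p _ _]]] := eqVneq (range (fun p => `|f p|)) set0.
  by rewrite sup0.
exact: le_trans (crect_norm_ge f p).
Qed.

Local Lemma crect_normD (f g : C) :
  crect_norm (f + g) <= crect_norm f + crect_norm g.
Proof.
apply: crect_norm_le => [|p]; first by rewrite addr_ge0 ?crect_norm_ge0.
by rewrite (le_trans (ler_normD _ _))// lerD ?crect_norm_ge.
Qed.

Local Lemma crect_normZ (k : R) (f : C) :
  crect_norm (k *: f) = `|k| * crect_norm f.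
Proof.
have le l (h : C) : crect_norm (l *: h) <= `|l| * crect_norm h.
  apply: crect_norm_le => [|p]; first by rewrite mulr_ge0 ?crect_norm_ge0.
  by rewrite [leLHS]normrM ler_wpM2l ?crect_norm_ge.
apply/eqP; rewrite eq_le le /=.
have [->|k0] := eqVneq k 0; first by rewrite normr0 mul0r crect_norm_ge0.
rewrite -ler_pdivlMl ?normr_gt0// -normfV.
by rewrite -{1}[f]scale1r -(mulVf k0) -scalerA.
Qed.

Local Lemma crect_norm0_eq0 (f : C) : crect_norm f = 0 -> f = 0.
Proof.
move=> f0; apply: crectP => p; apply/eqP.
by rewrite -[_ == _]/(f p == 0) -normr_le0 -f0 crect_norm_ge.
Qed.

HB.instance Definition _ := Lmodule_isNormed.Build R C
  crect_normD crect_normZ crect_norm0_eq0.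

Lemma crect_normE (f : C) : `|f| = sup (range (fun p => `|f p|)).
Proof. by []. Qed.

(* Value at a point of the plane, with junk value 0 outside the rectangle. *)
Definition ceval (f : C) : R * R -> R := 'valL_0 f.

Lemma cevalE (f : C) (p : rect a b c d) : ceval f (val p) = f p.
Proof. exact: valL_val. Qed.

End crect_normed.

Section bernstein.
Context {R : realType} {a b c d : R}.

Definition bernstein (m n : nat) (f : crect a b c d) (p : R * R) : R :=
  ((b - a) ^+ m * (d - c) ^+ n)^-1 *
  \sum_(i < m.+1) \sum_(j < n.+1)
    ceval f (a + i%:R * (b - a) / m%:R, c + j%:R * (d - c) / n%:R) *
    'C(m, i)%:R * 'C(n, j)%:R *
    (p.1 - a) ^+ i * (b - p.1) ^+ (m - i) *
    (p.2 - c) ^+ j * (d - p.2) ^+ (n - j).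

End bernstein.

Definition homeomorphism_on (X Y : ptopologicalType) (A : set X) (B : set Y)
    (f : X -> Y) : Prop :=
  [/\ set_bij A B f, {within A, continuous f}
    & {within B, continuous (pinv A f)}].

Definition contraction_on (R : realType) (A : set R) (f : R -> R) : Prop :=
  exists2 k : R, 0 <= k < 1 & k.-lipschitz_A f.

(* The part of a net lying on one axis: the nodes a = t_0 < ... < t_N = b and
   the maps w_1, ..., w_N.  Only the values [node i] for i <= N and [fold i] on
   [a, b] for 1 <= i <= N are meaningful. *)
Record axis (R : realType) (a b : R) := Axis {
  pieces : nat;
  node : nat -> R;
  fold : nat -> R -> R;
  pieces_ge2 : (2 <= pieces)%N;
  node_first : node 0 = a;
  node_last : node pieces = b;
  node_lt : forall i, (i < pieces)%N -> node i < node i.+1;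
  fold_contraction : forall i, (1 <= i <= pieces)%N ->
    contraction_on `[a, b] (fold i);
  fold_homeomorphism : forall i, (1 <= i <= pieces)%N ->
    homeomorphism_on `[a, b] `[node i.-1, node i] (fold i);
  fold_odd : forall i, (1 <= i <= pieces)%N -> odd i ->
    fold i (node 0) = node i.-1 /\ fold i (node pieces) = node i;
  fold_even : forall i, (1 <= i <= pieces)%N -> ~~ odd i ->
    fold i (node 0) = node i /\ fold i (node pieces) = node i.-1
}.

Record net (R : realType) (a b c d : R) := Net {
  xaxis : axis a b;
  yaxis : axis c d
}.

Section fractal.
Context {R : realType} {a b c d : R} (Delta : net a b c d).
Local Notation X := (xaxis Delta).
Local Notation Y := (yaxis Delta).
Local Notation C := (crect a b c d).

Definition cell (i j : nat) : set (R * R) :=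
  `[node X i.-1, node X i] `*` `[node Y j.-1, node Y j].

Definition Qmap (i j : nat) (p : R * R) : R * R :=
  (pinv `[a, b] (fold X i) p.1, pinv `[c, d] (fold Y j) p.2).

Definition fractal_equation (m n : nat) (f alpha g : C) : Prop :=
  forall i j, (1 <= i <= pieces X)%N -> (1 <= j <= pieces Y)%N ->
  forall p, cell i j p ->
    ceval g p = ceval f p + ceval alpha p * ceval g (Qmap i j p)
                - ceval alpha p * bernstein m n f (Qmap i j p).

(* For `|alpha| < 1 the equation has exactly one solution, which [get] picks. *)
Definition fractal (m n : nat) (f alpha : C) : C :=
  get (fractal_equation m n f alpha).

Definition fractal_mapping (m n : nat) (f : C) : set C :=
  [set fractal m n f alpha | alpha in [set alpha : C | `|alpha| < 1]].

End fractal.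

Definition lower_semicontinuous_at (R : realType) (X Y : normedModType R)
    (T : X -> set Y) (x : X) : Prop :=
  forall U : set Y, open U -> U `&` T x !=set0 ->
    exists2 delta : R, 0 < delta &
      forall x' : X, `|x - x'| < delta -> U `&` T x' !=set0.

(* Main.v *)
(** The inverse folding maps of each axis agree at the common nodes, so the
    maps [Q_ij] glue to one continuous self-map [Q] of the rectangle, and the
    defining equation reads [g = f + alpha * (g - B f) o Q].  As [`|alpha| < 1],
    the Banach fixed point theorem in the complete space C([a, b] x [c, d])
    gives a solution.  Subtracting the equations for [f] and [f'] and using
    [`|B h| <= `|h|] shows that, for fixed [alpha], [f |-> f^alpha] is Lipschitz
    with constant [(1 + `|alpha|) / (1 - `|alpha|)].  So [f'^alpha], with the
    same [alpha], is near [f^alpha] as soon as [f'] is near [f]. *)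

From HB Require Import structures.
Require Import Defs.
From mathcomp Require Import all_boot all_order all_algebra.
From mathcomp Require Import all_classical all_reals all_analysis.
From mathcomp Require Import ring lra.

Set Implicit Arguments.
Unset Strict Implicit.
Unset Printing Implicit Defensive.

Import Order.TTheory GRing.Theory Num.Theory.
Import numFieldNormedType.Exports.

Local Open Scope classical_set_scope.
Local Open Scope ring_scope.

(** * Completeness of the space of continuous functions on the rectangle *)

Section crect_complete.
Context {R : realType} {a b c d : R}.
Local Notation C := (crect a b c d).

(** A sup-norm Cauchy filter is Cauchy at each point, uniformly in the point. The pointwise limit
    [l] is therefore a uniform limit, hence continuous. *)
Lemma crect_cauchy_cvg (F : set_system C) : ProperFilter F -> cauchy F -> cvg F.
Proof.
move=> FF /cauchy_ballP Fc.
have Fe (e : R) : 0 < e ->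
    \forall f & g \near F, forall p, `|(f : C) p - (g : C) p| <= e.
  move=> e0; apply: filterS (Fc _ e0) => -[f g]; rewrite -ball_normE /= => fg p.
  exact: le_trans (crect_norm_ge (f - g) p) (ltW fg).
have Fp p : cvg ((fun f : C => f p) @ F).
  apply/cauchy_cvgP/cauchy_ballP => e e0.
  (* [Fe] gives a weak inequality and a ball needs a strict one, hence [e / 2]. *)
  have [[A B] [FA FB] AB] := Fe (e / 2) (divr_gt0 e0 (ltr0Sn _ 1)).
  exists ((fun f : C => f p) @` A, (fun f : C => f p) @` B).
    by split; [apply: filterS FA|apply: filterS FB] => f Af; exists f.
  move=> [_ _] [[f Af <-] [g Bg <-]]; rewrite -ball_normE /=.
  apply: le_lt_trans (AB (f, g) _ p) _; first by split.
  by rewrite ltr_pdivrMr// ltr_pMr// ltr1n.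
pose l p := lim ((fun f : C => f p) @ F).
have Fl (e : R) : 0 < e -> \forall f \near F, forall p, `|(f : C) p - l p| <= e.
  move=> e0; have [[A B] [FA FB] AB] := Fe e e0.
  apply: filterS FA => f Af p.
  (* Let [g] tend to its limit with [f] fixed: the bound survives because the set of reals [r <= e]
     is closed. *)
  have : (fun g : C => `|f p - g p|) @ F --> `|f p - l p|.
    by apply: cvg_norm; apply: cvgB; [exact: cvg_cst|exact: Fp].
  apply: (@closed_cvg _ _ F _ _ [set r | r <= e]) => /=.
    exact: closed_le.
  by apply: filterS FB => g Bg; exact: (AB (f, g)).
have lc : continuous l.
  move=> p; have FFp := nbhs_filter p; apply/cvgrPdist_le => e e0.
  have e3 : 0 < e / 3 by rewrite divr_gt0.
  have [f fl] := filter_ex (Fl _ e3).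
  move: (@crect_cts _ _ _ _ _ f p) => /cvgrPdist_le /(_ _ e3).
  apply: filterS => q fpq.
  rewrite (_ : l p - l q = (l p - f p) + (f p - f q) + (f q - l q)); last first.
    by rewrite !addrA !subrK.
  rewrite (le_trans (ler_normD _ _))// [leRHS](_ : _ = e / 3 + e / 3 + e / 3).
    by rewrite lerD// (le_trans (ler_normD _ _))// lerD// distrC.
  by field.
apply/cvg_ex; exists (mkcts lc : C); apply/cvgrPdist_le => e e0.
near=> f; apply: crect_norm_le; first exact: ltW.
move=> p; rewrite /= -[(_ - _ : C) p]/(l p - f p) distrC; move: p.
by near: f; exact: Fl.
Unshelve. all: by end_near. Qed.

HB.instance Definition _ := Uniform_isComplete.Build C crect_cauchy_cvg.

End crect_complete.

(** * Gluing the inverse folding maps along one axis *)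

Section axis.
Context {R : realType} {a b : R} (X : axis a b).

Lemma node_le i j : (i <= j <= pieces X)%N -> node X i <= node X j.
Proof.
elim: j => [|j IH]; first by rewrite leqn0 => /andP[/eqP->].
rewrite leq_eqVlt ltnS => /andP[/predU1P[->//|ij] jN].
by rewrite (le_trans (IH _) (ltW (node_lt jN)))// ij ltnW.
Qed.

Lemma mem_piece t : t \in `[a, b] ->
  exists2 i, (1 <= i <= pieces X)%N & t \in `[node X i.-1, node X i].
Proof.
rewrite in_itv/= => /andP[]; rewrite -[leLHS](node_first X) => at0.
rewrite -[leRHS](node_last X); move: (leqnn (pieces X)).
(* Descend from the last node to the first [node X k] that no longer bounds [t] from above. If none
   is met, [t] is the first node and lies in piece 1. *)
elim: {1 3}(pieces X) => [|k IH] kN tk.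
  exists 1%N; first by rewrite (ltn_trans _ (pieces_ge2 X)).
  rewrite in_itv/= at0 (le_trans tk)// node_le//=.
  by rewrite (ltn_trans _ (pieces_ge2 X)).
have [tk'|tk'] := leP t (node X k); first exact: IH (ltnW kN) tk'.
by exists k.+1 => //; rewrite in_itv/= tk ltW.
Qed.

Lemma pinv_fold_itv i t : (1 <= i <= pieces X)%N ->
  t \in `[node X i.-1, node X i] -> pinv `[a, b] (fold X i) t \in `[a, b].
Proof.
move=> /(@fold_homeomorphism _ _ _ X i) [[_ _ sf] _ _] ti.
by apply: (surjpinv_image_sub sf); exists t.
Qed.

Lemma pinv_foldK i t : (1 <= i <= pieces X)%N -> t \in `[a, b] ->
  pinv `[a, b] (fold X i) (fold X i t) = t.
Proof.
move=> /(@fold_homeomorphism _ _ _ X i) [[_ jf _] _ _] ti.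
by apply: pinvKV; rewrite ?inE.
Qed.

Lemma axis_le : a <= b.
Proof.
by rewrite -[leLHS](node_first X) -[leRHS](node_last X) node_le ?leqnn.
Qed.

(* Consecutive folding maps have opposite orientations, so that both inverses
   take the same value (an end point of [a, b]) at the common node. *)
Lemma pinv_fold_node i : (1 <= i < pieces X)%N ->
  pinv `[a, b] (fold X i) (node X i) = pinv `[a, b] (fold X i.+1) (node X i).
Proof.
move=> /andP[i1 iN].
have iN' : (1 <= i <= pieces X)%N by rewrite i1 ltnW.
have iN'' : (1 <= i.+1 <= pieces X)%N by rewrite iN.
have aab : a \in `[a, b] by rewrite in_itv/= lexx axis_le.
have bab : b \in `[a, b] by rewrite in_itv/= lexx axis_le.
have [oi|ei] := boolP (odd i).
  have [_ e1] := fold_odd iN' oi.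
  have [|_ e2] := fold_even iN''; first by rewrite /= oi.
  rewrite -{1}e1 -[node X i]/(node X i.+1.-1) -e2 node_last.
  by rewrite !pinv_foldK.
have [e1 _] := fold_even iN' ei.
have [|e2 _] := fold_odd iN''; first by rewrite /= ei.
rewrite -{1}e1 -[node X i]/(node X i.+1.-1) -e2 node_first.
by rewrite !pinv_foldK.
Qed.

(** Pasting lemma, one piece at a time: each inverse is continuous on its closed piece, and
    neighbouring inverses agree at the common node by [pinv_fold_node]. *)
Lemma unfolding_exists : exists q : R -> R,
  {within `[a, b], continuous q} /\
  forall i, (1 <= i <= pieces X)%N -> forall t,
    t \in `[node X i.-1, node X i] -> q t = pinv `[a, b] (fold X i) t.
Proof.
suff /(_ (pieces X)) : forall k, (1 <= k <= pieces X)%N -> exists q : R -> R,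
    {within `[node X 0, node X k], continuous q} /\
    forall i, (1 <= i <= k)%N -> forall t,
      t \in `[node X i.-1, node X i] -> q t = pinv `[a, b] (fold X i) t.
  rewrite node_first node_last leqnn andbT.
  by apply; exact: ltnW (pieces_ge2 X).
elim=> [//|[|k] IH] /andP[_ kN].
  exists (pinv `[a, b] (fold X 1)); split.
    by have [] := @fold_homeomorphism _ _ _ X 1.
  by case=> [|[|]].
have [|q [qc qE]] := IH; first exact: ltnW kN.
pose r t := if t <= node X k.+1 then q t else pinv `[a, b] (fold X k.+2) t.
(* At the common node [r] takes its value from [q]; agreement there makes [r] equal to the new
   inverse on the whole closed piece. *)
have rE t : t \in `[node X k.+1, node X k.+2] ->
    r t = pinv `[a, b] (fold X k.+2) t.
  rewrite in_itv/= /r => /andP[kt _]; case: ifPn => // tk.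
  have -> : t = node X k.+1 by apply/eqP; rewrite eq_le tk kt.
  rewrite (qE k.+1) ?leqnn//; last first.
    by rewrite in_itv/= lexx andbT node_le// leqnSn ltnW.
  by rewrite pinv_fold_node.
exists r; split; last first.
  move=> i /andP[i1]; rewrite leq_eqVlt => /predU1P[->|ik] t; first exact: rE.
  move=> ti; rewrite /r ifT; first by apply: qE; rewrite ?i1.
  move: ti; rewrite in_itv/= => /andP[_ /le_trans]; apply.
  by rewrite node_le// -ltnS ik ltnW.
have split_itv : `[node X 0, node X k.+2]%classic =
    `[node X 0, node X k.+1] `|` `[node X k.+1, node X k.+2].
  apply/seteqP; split => t /=; rewrite !in_itv/=.
    move=> /andP[-> ->]; rewrite andbT.
    by have [tk|/ltW tk] := leP t (node X k.+1); [left|right].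
  move=> [/andP[-> /le_trans]|/andP[kt ->]] /=.
    by apply; rewrite node_le// leqnSn.
  by rewrite andbT (le_trans _ kt)// node_le//= (ltnW kN).
rewrite split_itv; apply: withinU_continuous; try exact: interval_closed.
  apply: (subspace_eq_continuous _ qc) => t; rewrite inE/= in_itv/=.
  by rewrite /from_subspace/= /r => /andP[_ ->].
have [_ _] := @fold_homeomorphism _ _ _ X k.+2 kN.
apply: subspace_eq_continuous => t.
by rewrite inE /= => ti; rewrite /from_subspace/= rE.
Qed.

End axis.

(** Factor [h] through the subtype of [A], where continuity of [q] within [A] becomes plain
    continuity of its restriction. *)
Lemma within_continuous_comp_sub (T X Y : topologicalType) (A : set X)
    (h : T -> X) (q : X -> Y) : (forall t, A (h t)) ->
  continuous h -> {within A, continuous q} -> continuous (q \o h).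
Proof.
move=> hA hc /subspace_sigL_continuousP qc.
pose k t : A := exist _ (h t) (mem_set (hA t)).
have kc : continuous k by apply: continuous_comp_initial.
by move=> t; apply: (@continuous_comp _ _ _ k (sigL A q));
  [exact: kc|exact: qc].
Qed.

(** * The Bernstein operator as a linear map of norm at most one *)

Section bernstein_theory.
Context {R : realType} {a b c d : R} (m n : nat).
Local Notation C := (crect a b c d).

(** Outside the rectangle the junk value 0 satisfies the bound too, so the sample points of
    [bernstein] need no membership check. *)
Lemma ceval_le_norm (f : C) p : `|ceval f p| <= `|f|.
Proof.
have [pR|pR] := pselect (rect a b c d p).
  rewrite -[p]/(val (exist _ p (mem_set pR) : rect a b c d)) cevalE.
  exact: crect_norm_ge.
rewrite /ceval /valL_ oinv_set_val /= insubN ?normr0//.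
by apply/negP; rewrite inE.
Qed.

Lemma cevalB (f g : C) p : ceval (f - g) p = ceval f p - ceval g p.
Proof.
have [pR|pR] := pselect (rect a b c d p).
  by rewrite -[p]/(val (exist _ p (mem_set pR) : rect a b c d)) !cevalE.
rewrite /ceval /valL_ oinv_set_val /= insubN ?subr0//.
by apply/negP; rewrite inE.
Qed.

Lemma bernstein_continuous (f : C) : continuous (bernstein m n f).
Proof.
have cX (g : R * R -> R) k : continuous g -> continuous (fun p => g p ^+ k).
  move=> gc p; apply: (@continuous_comp _ _ _ g (fun x => x ^+ k)).
    exact: gc.
  exact: exprn_continuous.
have c1 e : continuous (fun p : R * R => p.1 - e).
  by move=> p; apply: cvgB; [exact: cvg_fst|exact: cvg_cst].
have c2 e : continuous (fun p : R * R => p.2 - e).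
  by move=> p; apply: cvgB; [exact: cvg_snd|exact: cvg_cst].
have c3 e : continuous (fun p : R * R => e - p.1).
  by move=> p; apply: cvgB; [exact: cvg_cst|exact: cvg_fst].
have c4 e : continuous (fun p : R * R => e - p.2).
  by move=> p; apply: cvgB; [exact: cvg_cst|exact: cvg_snd].
move=> p; apply: cvgM; first exact: cvg_cst.
apply: cvg_big => [|i _]; first exact: add_continuous.
apply: cvg_big => [|j _]; first exact: add_continuous.
apply: cvgM; last exact: cX.
apply: cvgM; last exact: cX.
apply: cvgM; last exact: cX.
apply: cvgM; last exact: cX.
exact: cvg_cst.
Qed.

Lemma bernsteinB (f g : C) p :
  bernstein m n (f - g) p = bernstein m n f p - bernstein m n g p.
Proof.
rewrite /bernstein -mulrBr -sumrB; congr (_ * _); apply: eq_bigr => i _.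
by rewrite -sumrB; apply: eq_bigr => j _; rewrite cevalB -!mulrBl.
Qed.

(** On the rectangle the Bernstein weights are nonnegative, and by the binomial theorem ([mass])
    they sum to the normalising constant, so the value is an average of samples of [f]. *)
Lemma bernstein_le_norm (f : C) p : a < b -> c < d -> rect a b c d p ->
  `|bernstein m n f p| <= `|f|.
Proof.
move=> ab cd [/=]; rewrite !in_itv/= => /andP[ax xb] /andP[cy yd].
have mass (u v w : R) k :
    \sum_(i < k.+1) 'C(k, i)%:R * ((w - u) ^+ i * (v - w) ^+ (k - i)) =
    (v - u) ^+ k.
  rewrite (_ : v - u = (v - w) + (w - u)); last by ring.
  rewrite exprDn; apply: eq_bigr => i _.
  by rewrite mulr_natl mulrC.
have K0 : 0 < (b - a) ^+ m * (d - c) ^+ n.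
  by rewrite mulr_gt0// exprn_gt0// subr_gt0.
rewrite /bernstein normrM gtr0_norm ?invr_gt0// mulrC ler_pdivrMr//.
rewrite -(mass a b p.1) -(mass c d p.2) big_distrl mulr_sumr/=.
apply: le_trans (ler_norm_sum _ _ _) _; apply: ler_sum => i _.
rewrite big_distrr mulr_sumr/=.
apply: le_trans (ler_norm_sum _ _ _) _; apply: ler_sum => j _.
set A := (p.1 - a) ^+ i; set B := (b - p.1) ^+ (m - i).
set A' := (p.2 - c) ^+ j; set B' := (d - p.2) ^+ (n - j).
rewrite (_ : ceval _ _ * _ * _ * _ * _ * _ * _ =
  ceval f (a + i%:R * (b - a) / m%:R, c + j%:R * (d - c) / n%:R) *
  ('C(m, i)%:R * (A * B) * ('C(n, j)%:R * (A' * B')))); last by ring.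
rewrite normrM [X in _ * X]ger0_norm ?ler_wpM2r ?ceval_le_norm//;
  by rewrite !mulr_ge0 ?exprn_ge0 ?subr_ge0.
Qed.

Lemma bernstein_crect_cts (f : C) :
  continuous (fun p : rect a b c d => bernstein m n f (val p)).
Proof.
move=> p; apply: (@continuous_comp _ _ _ set_val (bernstein m n f)).
  exact: initial_continuous.
exact: bernstein_continuous.
Qed.

Definition bernstein_crect (f : C) : C := mkcts (@bernstein_crect_cts f).

Lemma bernstein_crectB (f g : C) :
  bernstein_crect (f - g) = bernstein_crect f - bernstein_crect g.
Proof. by apply/continuousEP => p; exact: bernsteinB. Qed.

Lemma bernstein_crect_norm (f : C) : a < b -> c < d ->
  `|bernstein_crect f| <= `|f|.
Proof.
move=> ab cd; apply: crect_norm_le => // p.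
by apply: bernstein_le_norm => //; exact: set_valP.
Qed.

End bernstein_theory.

(** * The operator sending [h] to [alpha * (h \o Q)], and its fixed points *)

Section weighted_composition.
Context {R : realType} {a b c d : R}.
Local Notation C := (crect a b c d).
Context (Q : rect a b c d -> rect a b c d) (Qc : continuous Q) (alpha : C).

Lemma wcomp_cts (h : C) : continuous (fun p => alpha p * h (Q p)).
Proof.
move=> p; have FFp := nbhs_filter p; apply: cvgM; first exact: crect_cts.
by apply: (@continuous_comp _ _ _ Q h); [exact: Qc|exact: crect_cts].
Qed.

Definition wcomp (h : C) : C := mkcts (@wcomp_cts h).

Lemma wcompB (h k : C) : wcomp (h - k) = wcomp h - wcomp k.
Proof. by apply/continuousEP => p; exact: mulrBr. Qed.

Lemma wcomp_norm (h : C) : `|wcomp h| <= `|alpha| * `|h|.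
Proof.
apply: crect_norm_le => [|p]; first by rewrite mulr_ge0.
by rewrite normrM ler_pM ?crect_norm_ge.
Qed.

(** By [wcompB] and [wcomp_norm] the right-hand side is a contraction in [g] with constant the norm
    of [alpha]. *)
Lemma wcomp_fixed_point (f : C) : `|alpha| < 1 -> exists g, g = f + wcomp g.
Proof.
move=> alpha1; pose T (g : C) : C := f + wcomp g.
have [|||g _ gE] := @banach_fixed_point R C setT (totalfun T).
- exists (NngNum (normr_ge0 alpha)); split => //= -[g h] _ /=.
  by rewrite /T opprD addrACA subrr add0r -wcompB wcomp_norm.
- exact: closedT.
- by exists 0.
by exists g.
Qed.

End weighted_composition.

(** * The fractal function and its Lipschitz dependence on [f] *)

Section fractal_theory.
Context {R : realType} {a b c d : R} (Delta : net a b c d).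
Local Notation X := (xaxis Delta).
Local Notation Y := (yaxis Delta).
Local Notation C := (crect a b c d).

Lemma Qmap_glue : exists2 Q : rect a b c d -> rect a b c d, continuous Q &
  forall i j, (1 <= i <= pieces X)%N -> (1 <= j <= pieces Y)%N ->
  forall p : rect a b c d, cell Delta i j (val p) ->
    val (Q p) = Qmap Delta i j (val p).
Proof.
have [q1 [q1c q1E]] := unfolding_exists X.
have [q2 [q2c q2E]] := unfolding_exists Y.
have Qrect (p : rect a b c d) : rect a b c d (q1 (val p).1, q2 (val p).2).
  have [/= /(mem_piece X) [i iN xi] /(mem_piece Y) [j jM yj]] := set_valP p.
  split => /=; first by rewrite (q1E i)// pinv_fold_itv.
  by rewrite (q2E j)// pinv_fold_itv.
pose Q p : rect a b c d := SigSub (mem_set (Qrect p)).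
have vc : continuous (@set_val _ (rect a b c d)) by exact: initial_continuous.
have c1 : continuous (q1 \o (fun p : rect a b c d => (set_val p).1)).
  apply: (within_continuous_comp_sub _ _ q1c) => p; first by case: (set_valP p).
  by apply: (@continuous_comp _ _ _ set_val fst); [exact: vc|exact: cvg_fst].
have c2 : continuous (q2 \o (fun p : rect a b c d => (set_val p).2)).
  apply: (within_continuous_comp_sub _ _ q2c) => p; first by case: (set_valP p).
  by apply: (@continuous_comp _ _ _ set_val snd); [exact: vc|exact: cvg_snd].
exists Q.
  apply: continuous_comp_initial => p; have FFp := nbhs_filter p.
  exact: (cvg_pair (c1 p) (c2 p)).
move=> i j iN jM p [/= xi yj]; rewrite /Qmap /=.
by rewrite (q1E i)// (q2E j).
Qed.

Lemma cell_rect i j : (1 <= i <= pieces X)%N -> (1 <= j <= pieces Y)%N ->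
  cell Delta i j `<=` rect a b c d.
Proof.
have sub (u v : R) (A : axis u v) k x : (1 <= k <= pieces A)%N ->
    x \in `[node A k.-1, node A k] -> x \in `[u, v].
  move=> /andP[k1 kN]; rewrite !in_itv/= => /andP[kx xk].
  rewrite -[X in X <= x](node_first A) -[X in x <= X](node_last A).
  rewrite (le_trans _ kx) ?(le_trans xk)// node_le ?kN ?leqnn//=.
  by rewrite (leq_trans (leq_pred _)).
by move=> iN jM p [/= /(sub _ _ _ _ _ iN) xi /(sub _ _ _ _ _ jM) yj].
Qed.

Context (Q : rect a b c d -> rect a b c d) (Qc : continuous Q).
Hypothesis QE : forall i j, (1 <= i <= pieces X)%N -> (1 <= j <= pieces Y)%N ->
  forall p : rect a b c d, cell Delta i j (val p) ->
    val (Q p) = Qmap Delta i j (val p).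

(** The cells cover the rectangle, which gives the forward direction, and lie inside it, which gives
    the converse. *)
Lemma fractal_equationP m n (f alpha g : C) :
  fractal_equation Delta m n f alpha g <->
  g = f + wcomp Qc alpha (g - bernstein_crect m n f).
Proof.
split=> [eqg|gE i j iN jM p pc].
  apply/continuousEP => p.
  have [/= /(mem_piece X) [i iN xi] /(mem_piece Y) [j jM yj]] := set_valP p.
  have pc : cell Delta i j (val p) by [].
  rewrite -cevalE (eqg i j)// -(QE iN jM pc) !cevalE -addrA -mulrBr.
  by [].
have pR := cell_rect iN jM pc.
pose p' : rect a b c d := exist _ p (mem_set pR).
rewrite -[p]/(val p') -(QE iN jM)// !cevalE {1}gE -addrA -mulrBr.
by [].
Qed.

Lemma fractalP m n (f alpha : C) : `|alpha| < 1 ->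
  fractal Delta m n f alpha =
  f + wcomp Qc alpha (fractal Delta m n f alpha - bernstein_crect m n f).
Proof.
move=> alpha1; apply: (fractal_equationP m n f alpha _).1; apply: getPex.
(* The Bernstein term does not involve the unknown, so it is absorbed into the constant term of the
   fixed-point equation. *)
have [g gE] := wcomp_fixed_point Qc
  (f - wcomp Qc alpha (bernstein_crect m n f)) alpha1.
by exists g; apply: (fractal_equationP m n f alpha g).2;
  rewrite wcompB addrA addrAC.
Qed.

Lemma fractal_lipschitz m n (f g alpha : C) : a < b -> c < d -> `|alpha| < 1 ->
  `|fractal Delta m n f alpha - fractal Delta m n g alpha| <=
  (1 + `|alpha|) / (1 - `|alpha|) * `|f - g|.
Proof.
move=> ab cd alpha1.
set F := fractal Delta m n f alpha; set G := fractal Delta m n g alpha.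
have FG : F - G =
    (f - g) + wcomp Qc alpha ((F - G) - bernstein_crect m n (f - g)).
  rewrite {1}/F {1}/G fractalP// [in X in _ - X]fractalP// -/F -/G.
  rewrite opprD addrACA -wcompB bernstein_crectB; congr (_ + wcomp _ _ _).
  by rewrite !opprD addrACA.
rewrite mulrAC ler_pdivlMr ?subr_gt0//.
(* Collecting the terms in the norm of [F - G] on the left gives the factor [1 - |alpha|] and leaves
   [1 + |alpha|] on the right. *)
have : `|F - G| <= `|f - g| + `|alpha| * (`|F - G| + `|f - g|).
  rewrite {1}FG (le_trans (ler_normD _ _))// lerD2l.
  rewrite (le_trans (wcomp_norm _ _ _))// ler_wpM2l//.
  by rewrite (le_trans (ler_normB _ _))// lerD2l bernstein_crect_norm.
lra.
Qed.

End fractal_theory.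

Theorem theorem3p9 (R : realType) (a b c d : R) (hab : a < b) (hcd : c < d)
    (Delta : net a b c d) (m n : nat) (hm : (0 < m)%N) (hn : (0 < n)%N) :
  forall f : crect a b c d,
    lower_semicontinuous_at (fractal_mapping Delta m n) f.
Proof.
move=> f U Uo [_ [/[swap] [[alpha alpha1 <-]]] Uf].
have [Q Qc QE] := Qmap_glue Delta.
have [e /= e0 eU] := (nbhs_normP _ _).1 (open_nbhs_nbhs (conj Uo Uf)).
set L := (1 + `|alpha|) / (1 - `|alpha|).
have L0 : 0 < L by rewrite divr_gt0 ?subr_gt0// ltr_pwDl.
(* [e] is the radius of a ball around the fractal function of [f] inside [U], and [L] is the
   Lipschitz constant for the fixed [alpha]. *)
exists (e / L); first by rewrite divr_gt0.
move=> g fg; exists (fractal Delta m n g alpha); split; last by exists alpha.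
apply: eU => /=.
apply: le_lt_trans (fractal_lipschitz Qc QE _ _ _ _ _ _ _) _ => //.
by rewrite mulrC -ltr_pdivlMr.
Qed.
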